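(* Let $D=(V,A)$ be a finite digraph whose underlying undirected graph is chordal, and let $w:A\to\mathbb{Z}_{\ge 0}$ be an arc weight function. Then the minimum weight of a dicut of $D$ is equal to the maximum size of a packing of dijoins in $(D,w)$.
   Context: For a nonempty proper subset $U\subsetneqq V$, let $\delta^+(U)$ and $\delta^-(U)$ denote the sets of arcs of $D$ leaving and entering $U$, respectively. A dicut of $D$ is a set of arcs of the form $\delta^+(U)$, where $\emptyset\ne U\subsetneqq V$ and $\delta^-(U)=\emptyset$. The weight of a dicut is the sum of $w(e)$ over its arcs $e$. A dijoin of $D$ is a set of arcs that intersects every dicut of $D$ at least once. A packing of dijoins of size $k$ in $(D,w)$ is a list of $k$ dijoins $J_1,\dots,J_k$ (not necessarily distinct) such that no arc $e\in A$ is contained in more than $w(e)$ of $J_1,\dots,J_k$. An undirected graph is chordal if it has no chordless cycle of length more than $3$; the underlying undirected graph of $D$ is obtained by forgetting arc orientations. Convention: if $D$ has no dicut, then $\emptyset$ is a dijoin and both quantities are regarded as $+\infty$. *)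

(* Defs.v *)
From mathcomp Require Import all_boot.
Set Implicit Arguments.
Unset Strict Implicit.
Unset Printing Implicit Defensive.

(* Parallel arcs, opposite arcs and loops are all allowed. *)
Record digraph := Digraph {
  vertices : finType;
  arcs : finType;
  src : arcs -> vertices;
  tgt : arcs -> vertices
}.

Section UndirectedGraphs.
Variables (V : finType) (e : rel V).

(* For a duplicate-free closed walk [c], an edge between two vertices of [c]
   is a chord unless one endpoint is the cyclic successor of the other. *)
Definition chordless (c : seq V) : bool :=
  [forall x in c, forall y in c,
     e x y ==> ((y == next c x) || (x == next c y))].

Definition chordal : Prop :=
  forall c : seq V, ucycle e c -> 3 < size c -> ~~ chordless c.

End UndirectedGraphs.

Section Dicuts.
Variable D : digraph.

(* Adjacency only: multiplicities and loops are irrelevant to chordality. *)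
Definition underlying : rel (vertices D) := fun x y =>
  (x != y) && [exists a : arcs D,
    ((src a == x) && (tgt a == y)) || ((src a == y) && (tgt a == x))].

Definition delta_out (U : {set vertices D}) : {set arcs D} :=
  [set a | (src a \in U) && (tgt a \notin U)].

Definition delta_in (U : {set vertices D}) : {set arcs D} :=
  [set a | (src a \notin U) && (tgt a \in U)].

(* A dicut may be empty, which happens when the digraph is disconnected; then
   there is no dijoin. *)
Definition dicut (C : {set arcs D}) : bool :=
  [exists U : {set vertices D},
    [&& U != set0, U \proper [set: vertices D], delta_in U == set0
      & C == delta_out U]].

Definition dijoin (J : {set arcs D}) : bool :=
  [forall C : {set arcs D}, dicut C ==> (J :&: C != set0)].

Variable w : arcs D -> nat.

Definition weight (C : {set arcs D}) : nat := \sum_(a in C) w a.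

Definition packing (Js : seq {set arcs D}) : Prop :=
  all dijoin Js /\
  forall a : arcs D, count (fun J : {set arcs D} => a \in J) Js <= w a.

(* In the next two definitions [None] stands for +oo. *)
Definition is_min_dicut_weight (m : option nat) : Prop :=
  match m with
  | Some k => (exists2 C, dicut C & weight C = k)
              /\ (forall C, dicut C -> k <= weight C)
  | None => forall C, ~~ dicut C
  end.

(* [None] means that there are packings of arbitrarily large size. When there
   is no dicut, this is realized by lists of copies of [set0]. *)
Definition is_max_packing_size (m : option nat) : Prop :=
  match m with
  | Some k => (exists2 Js, packing Js & size Js = k)
              /\ (forall Js, packing Js -> size Js <= k)
  | None => forall n, exists2 Js, packing Js & n <= size Js
  end.

End Dicuts.

(* Main.v *)
(* View every arc [a] as [w a] unit copies; a packing of size [k] is then a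
   coloring of the copies in which every color meets every dicut. The coloring
   is built by deleting a simplicial vertex [v].

   By symmetry [v] has at least as many leaving as entering copies. Match every
   entering copy p -> v with a leaving copy v -> q and replace the pair by
   p -> q; replace each unmatched copy v -> q by m -> q, where [m] is the
   earliest out-neighbor of [v]. As the neighborhood of [v] is a clique, these
   join adjacent vertices, and no dicut weight drops. A coloring of the smaller
   digraph lifts back by giving p -> v and v -> q the color of p -> q.

   The lifted coloring can only fail on the dicut leaving {v} when [v] is a
   source. In that case there are at least [k] copies leaving [v], all turned
   into copies leaving [m], and since the out-neighbors of [v] form a chain with
   respect to the dicuts, a color needs only the one among its copies whose head
   comes last. All the others are free to be recolored, so that every color
   appears at [v]. *)
Require Import Defs.
From mathcomp Require Import all_boot.
Set Implicit Arguments.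
Unset Strict Implicit.
Unset Printing Implicit Defensive.

(** * Preliminaries: simplicial vertices, matchings and recolorings *)

Definition simplicial (V : finType) (e : rel V) (S : {set V}) (v : V) : Prop :=
  {in S &, forall x y, e v x -> e v y -> x != y -> e x y}.

Lemma exists_matching (T : finType) (X Y : {set T}) : #|Y| <= #|X| ->
  exists f g : T -> T, {in Y, forall y, f y \in X /\ g (f y) = y}.
Proof.
move=> leYX; pose f y := nth y (enum X) (index y (enum Y)).
pose g x := nth x (enum Y) (index x (enum X)).
exists f, g => y Yy.
have ltY : index y (enum Y) < size (enum Y) by rewrite index_mem mem_enum.
have ltX : index y (enum Y) < size (enum X).
  by apply: leq_trans ltY _; rewrite -!cardE.
split; first by rewrite -mem_enum mem_nth.
rewrite /g /f index_uniq ?enum_uniq // (set_nth_default y) //.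
by rewrite nth_index // mem_enum.
Qed.

(** A color needs only a minimizer of [f] in its class, so the other elements of [X] are free to
    take missing colors. *)
Lemma recoloring (T : finType) (f c : T -> nat) k (X : {set T}) : k <= #|X| ->
  exists c' : T -> nat, forall i, i < k -> exists x,
    [/\ x \in X, c' x = i & {in X, forall y, c y = i -> f x <= f y}].
Proof.
elim: k X => [|k IHk] X ltkX; first by exists c.
(* [x] gets the color [k]; if its old color is smaller, another element of that color must do at
   least as well. *)
suff [x Xx [x_k x_i]] : exists2 x, x \in X &
    {in X, forall y, c y = k -> f x <= f y} /\
    (forall i, i < k -> c x = i ->
       exists2 z, z \in X :\ x & c z = i /\ f z <= f x).
  have [|c' c'P] := IHk (X :\ x).
    by move: ltkX; rewrite (cardsD1 x) Xx.
  exists (fun y => if y == x then k else c' y) => i.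
  rewrite ltnS leq_eqVlt => /predU1P[-> | ltik].
    by exists x; rewrite eqxx.
  have [y [/setD1P[y'x Xy] c'y min_y]] := c'P i ltik.
  exists y; rewrite (negPf y'x); split=> // z Xz cz.
  have [eq_zx | z'x] := eqVneq z x; last by apply: min_y; rewrite // !inE z'x.
  have [u Xu [cu le_u]] : exists2 z, z \in X :\ x & c z = i /\ f z <= f x.
    by apply: x_i; rewrite // -eq_zx.
  by rewrite eq_zx (leq_trans _ le_u) // min_y.
have [/exists_inP[x0 Xx0 /eqP cx0]|no_k] := boolP [exists x in X, c x == k].
  have Px0 : (x0 \in X) && (c x0 == k) by rewrite Xx0 cx0 eqxx.
  have [x /andP[Xx /eqP cx] min_x] := @arg_minnP _ x0 [pred x in X | c x == k] f Px0.
  exists x => //; split=> [y Xy cy | i ltik cxi]; first by rewrite min_x //= Xy cy eqxx.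
  by rewrite -cxi cx ltnn in ltik.
have c'k y : y \in X -> c y != k.
  by move=> Xy; apply: contra no_k => cy; apply/exists_inP; exists y.
have [x Xx xP] : exists2 x, x \in X & c x < k ->
    exists2 z, z \in X :\ x & c z = c x /\ f z <= f x.
  have [/exists_inP[x Xx lekx]|le_k] := boolP [exists x in X, k <= c x].
    by exists x; rewrite // ltnNge lekx.
  (* All colors on [X] are below [k] and [X] has more than [k] elements, so two of them share a
     color; the one with the larger [f] is dispensable. *)
  have : ~~ dinjectiveb c (mem X).
    apply: contraL ltkX => inj_c; rewrite -leqNgt cardE -(size_map c) -(size_iota 0 k).
    apply: uniq_leq_size => // _ /mapP[y Xy ->].
    rewrite mem_iota /= add0n ltnNge; apply: contra le_k => lecy.
    by apply/exists_inP; exists y => //; rewrite -mem_enum.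
  case/dinjectivePn=> x Xx [y /andP[/= y'x Xy] cxy].
  have [le_xy | /ltnW le_yx] := leqP (f x) (f y).
    by exists y => // _; exists x; rewrite // !inE eq_sym y'x.
  by exists x => // _; exists y; rewrite // !inE y'x.
exists x => //; split=> [y Xy cy | i ltik cx]; last by rewrite -cx; apply: xP; rewrite cx.
by have := c'k y Xy; rewrite cy eqxx.
Qed.

(** * Ideals and the copies crossing them *)

Section Ideals.

Variable V : finType.
Implicit Types (S U : {set V}) (r : rel V).

(* The dicuts are the sets of arcs leaving an ideal of the relation formed by
   the arcs. *)
Definition ideal S r U : bool :=
  [&& U \subset S, U != set0, U != S
    & [forall x in S, forall y in S, r x y ==> (y \in U) ==> (x \in U)]].

Lemma idealP S r U :
  reflect [/\ U \subset S, U != set0, U != S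
            & {in S &, forall x y, r x y -> y \in U -> x \in U}]
          (ideal S r U).
Proof.
apply: (iffP and4P) => -[-> -> -> cl]; split=> //.
  move=> x y Sx Sy rxy Uy; move/forall_inP/(_ x Sx)/forall_inP/(_ y Sy): cl.
  by rewrite rxy Uy.
apply/forall_inP=> x Sx; apply/forall_inP=> y Sy.
by apply/implyP=> rxy; apply/implyP; apply: cl.
Qed.

Lemma ideal_dual S r U :
  ideal S r U -> ideal S (fun x y => r y x) (S :\: U).
Proof.
case/idealP=> sUS U0 U'S cl; apply/idealP; split; first exact: subsetDl.
- by rewrite setD_eq0; apply: contra U'S => sSU; rewrite eqEsubset sUS.
- apply: contra U0 => /eqP defS; rewrite -subset0; apply/subsetP=> x Ux.
  by have := subsetP sUS x Ux; rewrite -defS inE Ux.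
move=> x y Sx Sy ryx /setDP[_ U'y]; rewrite inE Sx andbT.
by apply: contra U'y; apply: cl.
Qed.

(* The ideals are nested on a clique, and [depth] orders the clique accordingly:
   a vertex of larger depth enters the ideals earlier, even if the clique
   contains directed cycles. *)
Definition depth S r x := #|[set U | ideal S r U && (x \in U)]|.

(** If [r y x] holds, every ideal containing [x] contains [y]; the comparison of depths then makes
    the two families of ideals equal. *)
Lemma depth_le S r x y U : x \in S -> y \in S -> r x y || r y x ->
  depth S r y <= depth S r x -> ideal S r U -> y \in U -> x \in U.
Proof.
move=> Sx Sy /orP[rxy | ryx] led idU Uy.
  by have /idealP[_ _ _ cl] := idU; apply: cl rxy Uy.
suff : U \in [set U | ideal S r U && (x \in U)] by rewrite inE idU.
suff /eqP -> : [set U | ideal S r U && (x \in U)] == [set U | ideal S r U && (y \in U)].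
  by rewrite inE idU.
rewrite eqEcard led andbT; apply/subsetP=> W; rewrite !inE => /andP[idW Wx].
by have /idealP[_ _ _ cl] := idW; rewrite idW; apply: cl ryx Wx.
Qed.

Variable T : finType.
Implicit Types (s t : T -> V).

Definition crossing s t U : {set T} := [set a | (s a \in U) && (t a \notin U)].

(* A copy is discarded by turning it into a loop. *)
Definition well_placed S r s t : Prop :=
  forall a, s a != t a -> [/\ s a \in S, t a \in S & r (s a) (t a)].

Definition dijoin_coloring S r s t k : Prop :=
  exists c : T -> nat, forall U i, ideal S r U -> i < k ->
    exists2 a, a \in crossing s t U & c a = i.

Variable e : rel V.

Definition orients S r : Prop :=
  {in S &, forall x y, x != y -> e x y = r x y || r y x}.

(** Deleting a vertex changes the orientation and moves the copies; only [T] and [e] stay fixed in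
    the induction. *)
Definition colorable S k : Prop := forall r s t,
  orients S r -> well_placed S r s t ->
  (forall U, ideal S r U -> k <= #|crossing s t U|) ->
  dijoin_coloring S r s t k.

(** The composites through [v] preserve, after its deletion, the closure conditions it imposed on
    the other vertices. *)
Definition bypass r (v : V) : rel V := fun x y => r x y || r x v && r v y.

(** * Elimination of a simplicial vertex *)

Section Elimination.

Variables (S : {set V}) (r : rel V) (v : V).
Hypothesis Sv : v \in S.

Lemma ideal_restrict U : ideal S r U -> U != [set v] -> U != S :\ v ->
  ideal (S :\ v) (bypass r v) (U :\ v).
Proof.
case/idealP=> sUS U0 U'S cl U'v U'Sv; apply/idealP; split.
- exact: setSD.
- apply: contra U'v; rewrite setD_eq0 => sUv.
  by rewrite eqEsubset sUv sub1set; have [x Ux] := set0Pn _ U0;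
    rewrite -(set1P (subsetP sUv x Ux)).
- have [Uv | U'v'] := boolP (v \in U).
    by apply: contra U'S => /eqP eqUS; rewrite -(setD1K Uv) eqUS setD1K.
  by rewrite (setDidPl _) // disjoint_sym disjoints1.
move=> x y /setD1P[x'v Sx] /setD1P[y'v Sy] rxy /setD1P[_ Uy].
rewrite !inE x'v; case/orP: rxy => [rxy | /andP[rxv rvy]]; first exact: cl rxy Uy.
by apply: (cl _ v) => //; apply: cl rvy Uy.
Qed.

Lemma ideal_without U : ideal (S :\ v) (bypass r v) U ->
  {in U, forall q, ~~ r v q} -> ideal S r U.
Proof.
case/idealP=> sUS' U0 U'S' cl Q'U; have sUS := subset_trans sUS' (subD1set S v).
have v'U : v \notin U by apply/negP=> /(subsetP sUS'); rewrite !inE eqxx.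
apply/idealP; split=> //.
  by apply: contraNneq v'U => ->.
move=> x y Sx Sy rxy Uy; have [x_v | x'v] := eqVneq x v.
  by rewrite x_v (negPf (Q'U y Uy)) in rxy.
have S'x : x \in S :\ v by rewrite !inE x'v.
have bxy : bypass r v x y by rewrite /bypass rxy.
exact: cl S'x (subsetP sUS' y Uy) bxy Uy.
Qed.

(** The predecessors of [v] are already in [U], since the bypass puts them before [q]. *)
Lemma ideal_with U q : ideal (S :\ v) (bypass r v) U -> q \in U -> r v q ->
  ideal S r (v |: U).
Proof.
case/idealP=> sUS' U0 U'S' cl Uq rvq; have sUS := subset_trans sUS' (subD1set S v).
have S'q := subsetP sUS' q Uq.
apply/idealP; split=> //; first by rewrite subUset sub1set Sv.
- by apply/set0Pn; exists v; rewrite !inE eqxx.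
- apply: contra U'S' => /eqP <-; rewrite setU1K //.
  by apply/negP=> /(subsetP sUS'); rewrite !inE eqxx.
move=> x y Sx Sy rxy; rewrite !inE.
have [//| x'v /=] := eqVneq x v; have S'x : x \in S :\ v by rewrite !inE x'v.
case/predU1P=> [y_v | Uy].
  have bxq : bypass r v x q by rewrite y_v in rxy; rewrite /bypass rxy rvq orbT.
  exact: cl S'x S'q bxq Uq.
have bxy : bypass r v x y by rewrite /bypass rxy.
exact: cl S'x (subsetP sUS' y Uy) bxy Uy.
Qed.

(** The neighbors of [v] form a clique, so the bypass relates no two distinct nonadjacent
    vertices. *)
Lemma orients_bypass : simplicial e S v -> orients S r ->
  orients (S :\ v) (bypass r v).
Proof.
move=> simpl_v or_r x y /setD1P[x'v Sx] /setD1P[y'v Sy] x'y.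
have evE z : z != v -> z \in S -> e v z = r v z || r z v.
  by move=> z'v Sz; apply: or_r; rewrite // eq_sym.
have adj : r v x || r x v -> r v y || r y v -> e x y.
  by rewrite -!evE // => evx evy; apply: simpl_v.
apply/idP/idP; first by rewrite or_r // /bypass => /orP[]->; rewrite ?orbT.
case/orP=> /orP[rxy | /andP[rv1 rv2]]; first by rewrite or_r ?rxy.
- by rewrite adj ?rv1 ?rv2 ?orbT.
- by rewrite or_r ?rxy ?orbT.
by rewrite adj ?rv1 ?rv2 ?orbT.
Qed.

Variables (s t : T -> V) (k : nat).
Hypotheses (simpl_v : simplicial e S v) (or_r : orients S r).
Hypotheses (wp : well_placed S r s t) (k_gt0 : 0 < k).
Hypothesis le_k : forall U, ideal S r U -> k <= #|crossing s t U|.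
Hypothesis IH : colorable (S :\ v) k.

Lemma eliminate_simplicial :
    #|[set a | (s a != v) && (t a == v)]| <= #|[set a | (s a == v) && (t a != v)]| ->
  dijoin_coloring S r s t k.
Proof.
set Y := [set a | _]; set X := [set a | _] => leYX.
pose S' := S :\ v; pose r' := bypass r v.
have S'P x : reflect (x != v /\ x \in S) (x \in S') by apply: setD1P.
have or_r' : orients S' r' by apply: orients_bypass.
have Xs x : x \in X -> [/\ s x = v, t x \in S' & r v (t x)].
  rewrite inE => /andP[/eqP sx tx]; have [|_ Stx] := wp (a := x); first by rewrite sx eq_sym.
  by rewrite sx => ->; split=> //; apply/S'P.
have Ys y : y \in Y -> [/\ t y = v, s y \in S' & r (s y) v].
  rewrite inE => /andP[sy /eqP ty]; have [|Ssy _] := wp (a := y); first by rewrite ty.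
  by rewrite ty => ->; split=> //; apply/S'P.
have XY x : x \in X -> (x \in Y) = false.
  by rewrite !inE => /andP[-> _].
have others a : a \notin X -> a \notin Y -> s a != t a ->
    [/\ s a \in S', t a \in S' & r' (s a) (t a)].
  rewrite !inE => X'a Y'a st; have [Ssa Sta rst] := wp st.
  move: X'a Y'a; rewrite Ssa Sta !andbT negb_and negb_and !negbK /r' /bypass rst.
  have [sa | //] := eqVneq (s a) v; have [ta | //] := eqVneq (t a) v.
  by rewrite sa ta eqxx in st.
(* If [v] has no out-neighbor, then [X] and hence [Y] are empty. Any ideal would then make [S'] an
   ideal crossed by no copy, against [0 < k]. *)
have [Q0 | [q0 /setIdP[S'q0 rvq0]]] := set_0Vmem [set q in S' | r v q].
  have X0 : X = set0.
    apply: contra_eq Q0 => /set0Pn[x /Xs[_ S'tx rvt]].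
    by apply/set0Pn; exists (t x); rewrite inE S'tx.
  have Y0 : Y = set0 by move: leYX; rewrite X0 cards0 leqn0 cards_eq0 => /eqP.
  exists (fun=> 0) => U i idU _; exfalso.
  have /idealP[sUS U0 U'S cl] := idU.
  have idS' : ideal S r S'.
    apply/idealP; split; first exact: subD1set.
    - apply: contraNneq U'S => S'0; rewrite eqEsubset sUS; apply/subsetP=> y Sy.
      have eqv z : z \in S -> z = v.
        by move=> Sz; apply: contra_eq S'0 => z'v; apply/set0Pn; exists z; apply/S'P.
      by have [x Ux] := set0Pn _ U0; rewrite (eqv y Sy) -(eqv x (subsetP sUS x Ux)).
    - by apply/eqP=> eqS; have := Sv; rewrite -eqS !inE eqxx.
    move=> x y Sx Sy rxy S'y; rewrite !inE Sx andbT.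
    by apply/eqP=> x_v; have := in_set0 y; rewrite -Q0 inE S'y -x_v rxy.
  have := le_k idS'; rewrite leqNgt (leq_ltn_trans _ k_gt0) // leqn0 cards_eq0 -subset0.
  apply/subsetP=> a; rewrite inE => /andP[S'sa S'ta]; rewrite -Y0 inE.
  have /S'P[s'v _] := S'sa; rewrite s'v.
  have [|_ Sta _] := @wp a; first by apply: contraNneq S'ta => <-.
  by move: S'ta; rewrite !inE Sta andbT negbK.
pose dep := depth S' r'.
(* Having the greatest depth, [m] lies in every ideal of [S'] that contains an out-neighbor of
   [v]. *)
have [m Q_m max_m] : exists2 m, (m \in S') && r v m &
    forall q, q \in S' -> r v q -> dep q <= dep m.
  have [|m Pm maxm] := @arg_maxnP _ q0 [pred q in S' | r v q] dep; first by rewrite /= S'q0.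
  by exists m => // q S'q rvq; apply: maxm; rewrite /= S'q.
have{Q_m} [S'm rvm] := andP Q_m.
have le_dep p q U : p \in S' -> q \in S' -> r v p -> r v q ->
    dep q <= dep p -> ideal S' r' U -> q \in U -> p \in U.
  move=> S'p S'q rvp rvq led idU Uq; have [-> // | p'q] := eqVneq p q.
  have /S'P[p'v Sp] := S'p; have /S'P[q'v Sq] := S'q.
  apply: depth_le led idU Uq; rewrite // -or_r' // simpl_v ?or_r ?rvp ?rvq // eq_sym //.
have [phi [psi match_phi]] := exists_matching leYX.
(* A matched pair is replaced by moving the entering copy and discarding the
   leaving one. *)
pose matched a := (psi a \in Y) && (phi (psi a) == a).
pose s' a := if a \in X then (if ~~ matched a && r' m (t a) then m else t a) else s a.
pose t' a := if a \in Y then t (phi a) else t a.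
have wp' : well_placed S' r' s' t'.
  move=> a; rewrite /s' /t'; have [Xa | X'a] := boolP (a \in X).
    rewrite XY //; case: ifP => [/andP[_ ->] _|]; last by rewrite eqxx.
    by have [_ -> _] := Xs a Xa.
  have [Ya _ | Y'a] := boolP (a \in Y); last exact: others.
  have [Xpa _] := match_phi a Ya; have [_ -> rvt] := Xs _ Xpa.
  by have [_ -> rsv] := Ys a Ya; rewrite /r' /bypass rsv rvt orbT.
have m_first U x : ideal S' r' U -> x \in X -> t x \in U -> m \in U.
  by move=> idU /Xs[_ S'tx rvt]; apply: le_dep => //; apply: max_m.
(* Discarding a leaving copy when [r' m (t x)] fails costs nothing: either its head is [m], or its
   head precedes [m] and so lies in every ideal containing [m]. *)
have live U x : ideal S' r' U -> x \in X -> m \in U -> t x \notin U -> r' m (t x).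
  move=> idU Xx Um U'tx; have [_ S'tx rvt] := Xs x Xx.
  have m'tx : m != t x by apply: contraNneq U'tx => <-.
  have /S'P[m'v Sm] := S'm; have /S'P[t'v Stx] := S'tx.
  have : e m (t x) by rewrite simpl_v ?or_r ?rvm ?rvt // eq_sym.
  rewrite or_r' // => /orP[// | r'tm].
  by have /idealP[_ _ _ cl] := idU; rewrite (cl (t x) m) in U'tx.
have le_k' U : ideal S' r' U -> k <= #|crossing s' t' U|.
  move=> idU; have /idealP[sUS' _ _ cl] := idU.
  have v'U : v \notin U by apply/negP=> /(subsetP sUS'); rewrite !inE eqxx.
  have [/exists_inP[q Uq rvq] | no_q] := boolP [exists q in U, r v q].
    have S'q := subsetP sUS' q Uq.
    apply: leq_trans (le_k (ideal_with idU Uq rvq)) _.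
    (* A matched leaving copy is replaced by its partner, which now runs to the same head. The
       partner originally ended in [v], so it did not cross [v |: U] and [h] is injective. *)
    pose h a := if (a \in X) && matched a then psi a else a.
    have h_in : {in crossing s t (v |: U), forall a, h a \in crossing s' t' U}.
      move=> a; rewrite inE !in_setU1 negb_or => /andP[s_in /andP[ta U'ta]].
      rewrite inE /h.
      have [Xa | X'a] := boolP (a \in X); last first.
        move: s_in; rewrite /s' /t' (negPf X'a).
        have Y'a : a \in Y = false by rewrite inE (negPf ta) andbF.
        rewrite Y'a U'ta andbT => /predU1P[sa | //].
        by move: X'a; rewrite inE sa eqxx ta.
      have [/andP[Ypa /eqP ppa]|not_m] /= := boolP (matched a).
        have [_ S'sp rsv] := Ys _ Ypa; rewrite /s' /t' Ypa ppa U'ta andbT.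
        case: ifP => [Xpa | _]; first by rewrite XY in Ypa.
        by apply: cl Uq => //; rewrite /r' /bypass rsv rvq orbT.
      have Um : m \in U.
        by apply: (le_dep m q) => //; apply: max_m.
      by rewrite /s' /t' Xa not_m XY //= U'ta (live _ _ idU) // Um.
    rewrite -(card_in_imset (f := h)).
      by apply/subset_leq_card/subsetP=> _ /imsetP[a /h_in ha ->].
    move=> a b; rewrite /h !inE !negb_or => /andP[_ /andP[ta _]] /andP[_ /andP[tb _]].
    have Y'tv c : t c != v -> c \in Y = false by move=> tc; rewrite inE (negPf tc) andbF.
    case: ifP => [/andP[_ /andP[Ya /eqP pa]]|_];
      case: ifP => [/andP[_ /andP[Yb /eqP pb]]|_] //.
    - by move=> eqab; rewrite -pa -pb eqab.
    - by move=> eqab; rewrite eqab Y'tv in Ya.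
    by move=> eqab; rewrite -eqab Y'tv in Yb.
  have Q'U : {in U, forall q, ~~ r v q}.
    by move=> q Uq; apply: contra no_q => rvq; apply/exists_inP; exists q.
  (* A copy entering [v] from [U] now ends in an out-neighbor of [v], which is again outside [U]. *)
  apply: leq_trans (le_k (ideal_without idU Q'U)) _.
  apply/subset_leq_card/subsetP=> a; rewrite !inE => /andP[Usa U'ta].
  have X'a : a \in X = false.
    by apply/negP=> /Xs[sa _ _]; rewrite sa (negPf v'U) in Usa.
  rewrite /s' /t' X'a Usa /=; case: ifP => // Ya.
  have [/Xs[_ _ rvt] _] := match_phi a Ya.
  by apply/negP=> /Q'U; rewrite rvt.
have [c cP] := IH or_r' wp' le_k'.

(* Color [i] crosses an ideal of [S'] by a copy away from [v], by a matched pair of that color, or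
   by a leaving copy with [m] inside and its head outside. *)
have [c' liftP all_k] : exists2 c' : T -> nat,
    forall U i, ideal S' r' U -> i < k ->
      [\/ exists a, [/\ a \notin X, a \notin Y, a \in crossing s t U & c' a = i],
          exists y x, [/\ y \in Y, x \in X, s y \in U, t x \notin U & c' y = i /\ c' x = i]
        | exists x, [/\ x \in X, m \in U, t x \notin U & c' x = i]]
  & ideal S r [set v] -> forall i, i < k -> exists2 x, x \in X & c' x = i.
  have [idv | no_v] := boolP (ideal S r [set v]).
    have cross_v : crossing s t [set v] = X by apply/setP=> a; rewrite !inE.
    have := le_k idv; rewrite cross_v => le_kX.
    have Y0 a : (a \in Y) = false.
      apply/negP=> /Ys[_ /S'P[s'v Ss] rsv]; have /idealP[_ _ _ cl] := idv.
      by have := cl _ _ Ss Sv rsv (set11 v); rewrite inE (negPf s'v).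
    (* A head of smaller depth enters the ideals later: if some leaving copy of old color [i] has
       its head outside an ideal, so does the new representative of [i]. *)
    have [c1 c1P] := recoloring (fun x => dep (t x)) c le_kX.
    exists (fun a => if a \in X then c1 a else c a) => [U i idU ltik | _ i ltik]; last first.
      by have [x [Xx cx _]] := c1P i ltik; exists x; rewrite ?Xx.
    have [a + ca] := cP U i idU ltik; rewrite inE /s' /t' Y0.
    have [Xa | X'a] := boolP (a \in X); last first.
      by move=> cross_a; constructor 1; exists a; rewrite (negPf X'a) Y0 inE.
    case: ifP => [_|_]; last by rewrite andbN.
    case/andP=> Um U'ta; constructor 3.
    have [x [Xx cx min_x]] := c1P i ltik; exists x; split; rewrite ?Xx //.
    apply: contra U'ta; have [_ S'ta rvta] := Xs a Xa; have [_ S'tx rvtx] := Xs x Xx.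
    by apply: le_dep => //; apply: min_x.
  exists (fun a => if (a \in X) && matched a then c (psi a) else c a); last by [].
  move=> U i idU ltik; have [a + ca] := cP U i idU ltik; rewrite inE /s' /t'.
  have [Xa | X'a] := boolP (a \in X).
    rewrite XY //; case: ifP => [/andP[m'a _]|_]; last by rewrite andbN.
    by case/andP=> Um U'ta; constructor 3; exists a; rewrite Xa (negPf m'a).
  have [Ya | Y'a] := boolP (a \in Y) => cross_a; last first.
    by constructor 1; exists a; rewrite (negPf X'a) (negPf Y'a) inE.
  have [Xpa ppa] := match_phi a Ya; have [Usa U'ta] := andP cross_a.
  by constructor 2; exists a, (phi a); rewrite (negPf X'a) Xpa /matched ppa Ya eqxx.
exists c' => U i idU ltik; have [Uv | U'v] := eqVneq U [set v].
  rewrite Uv in idU *; have [x Xx cx] := all_k idU i ltik; exists x => //.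
  by move: Xx; rewrite !inE.
have /idealP[sUS _ _ cl] := idU.
(* [S'] is not closed, as it contains [q0] but not its predecessor [v]. *)
have U'S' : U != S'.
  apply/eqP=> US'; have := cl v q0 Sv; rewrite US' S'q0 !inE eqxx /=.
  by move=> /(_ (subsetP (subD1set S v) _ S'q0) rvq0 isT).
have idU' := ideal_restrict idU U'v U'S'.

have U'txP x : x \in X -> t x \notin U :\ v -> t x \notin U.
  by case/Xs=> _ /S'P[tx _] _; rewrite in_setD1 tx.
case: (liftP _ i idU' ltik) => [[a [X'a Y'a]] | [y [x [Yy Xx /setD1P[_ Usy] U'tx [cy cx]]]]
                               | [x [Xx /setD1P[_ Um] U'tx cx]]].
- rewrite inE => /andP[/setD1P[sa Usa] U'ta] ca; exists a => //.
  rewrite inE Usa; apply: contra Y'a => Uta; rewrite inE sa.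
  by rewrite in_setD1 Uta andbT negbK in U'ta.
- have [sx _ _] := Xs x Xx; have [ty _ _] := Ys y Yy.
  (* On whichever side [v] lies, one copy of the pair crosses [U]. *)
  have [Uv | U'v'] := boolP (v \in U).
    by exists x; rewrite // inE sx Uv U'txP.
  by exists y; rewrite // inE ty Usy.
have [sx _ _] := Xs x Xx; exists x; rewrite // inE sx U'txP // andbT.
exact: cl Sv (subsetP sUS m Um) rvm Um.
Qed.

End Elimination.

(** * Arc reversal and the induction on the vertex set *)

Lemma crossing_dual S r s t U : well_placed S r s t -> U \subset S ->
  crossing t s (S :\: U) = crossing s t U.
Proof.
move=> wp sUS; apply/setP=> a; rewrite !inE.
have [eq_st | /wp[-> -> _]] := eqVneq (s a) (t a); last by rewrite !andbT negbK andbC.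
by rewrite eq_st; case: (t a \in U); case: (t a \in S).
Qed.

(** Reversal replaces ideals by their complements and keeps the crossing copies. *)
Lemma dijoin_coloring_dual S r s t k : well_placed S r s t ->
  dijoin_coloring S (fun x y => r y x) t s k -> dijoin_coloring S r s t k.
Proof.
move=> wp [c cP]; exists c => U i idU ltik; have [a + ca] := cP _ i (ideal_dual idU) ltik.
by have /idealP[sUS _ _ _] := idU; rewrite (crossing_dual wp) //; exists a.
Qed.

Hypothesis simplicial_ex : forall S, S != set0 -> exists2 v, v \in S & simplicial e S v.

Lemma dijoin_coloring_chordal S k : colorable S k.
Proof.
have [-> r s t _ _ _ | k_gt0] := posnP k; first by exists (fun=> 0).
have [n] := ubnP #|S|; elim: n => // n IHn in S * => leSn r s t or_r wp le_k.
have [S0 | /simplicial_ex[v Sv simpl_v]] := eqVneq S set0.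
  exists (fun=> 0) => U i /idealP[]; rewrite S0 subset0 => /eqP->.
  by rewrite eqxx.
have IHv : colorable (S :\ v) k.
  by apply: IHn; move: leSn; rewrite (cardsD1 v) Sv.
have [leYX | /ltnW leXY] :=
    leqP #|[set a | (s a != v) && (t a == v)]| #|[set a | (s a == v) && (t a != v)]|.
  exact: eliminate_simplicial leYX.
apply: dijoin_coloring_dual => //.
have wp' : well_placed S (fun x y => r y x) t s.
  by move=> a; rewrite eq_sym => /wp[].
apply: (eliminate_simplicial Sv simpl_v) => //.
- by move=> x y Sx Sy x'y; rewrite orbC; apply: or_r.
- move=> U idU; have /idealP[sUS _ _ _] := idU.
  by rewrite -(crossing_dual wp') //; apply: le_k (ideal_dual idU).
apply: leq_trans (leq_trans _ leXY) _; apply/subset_leq_card/subsetP=> a;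
  by rewrite !inE andbC.
Qed.

End Ideals.

(** * Simplicial vertices of chordal graphs *)

Section Chordal.

Variables (V : finType) (e : rel V).

(** At the last index, the default value [x] of [nth] is the wrap-around of the cycle. *)
Lemma next_nth_uniq (x : V) p i : uniq (x :: p) -> i < size (x :: p) ->
  next (x :: p) (nth x (x :: p) i) = nth x p i.
Proof. by move=> Up ltip; rewrite next_nth mem_nth // index_uniq. Qed.

Lemma path_shortcut (y : V) q i j : path e y q -> i.+1 < j -> j < size (y :: q) ->
    e (nth y (y :: q) i) (nth y (y :: q) j) ->
  exists q', [/\ path e y q', last y q' = last y q, {subset q' <= q} & size q' < size q].
Proof.
case: j => // j; rewrite !ltnS => e_q ltij ltjq eij.
have last_take k : k <= size q -> last y (take k q) = nth y (y :: q) k.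
  by move=> lekq; rewrite (last_nth y) size_takel //;
    case: k lekq => //= k ltkq; rewrite nth_take.
have leiq : i <= size q by apply: leq_trans (ltnW ltij) (ltnW ltjq).
have dropE : drop j q = nth y q j :: drop j.+1 q by apply: drop_nth.
(* The chord joins positions [i] and [j.+1] of [y :: q]; the latter is position [j] of [q], where
   [drop j q] begins. *)
exists (take i q ++ drop j q); split.
- have [e_i _] : path e y (take i q) /\ path e (last y (take i q)) (drop i q).
    by apply/andP; rewrite -cat_path cat_take_drop.
  have [_ e_j] : path e y (take j.+1 q) /\ path e (last y (take j.+1 q)) (drop j.+1 q).
    by apply/andP; rewrite -cat_path cat_take_drop.
  by rewrite cat_path e_i last_take // dropE /= eij; rewrite last_take in e_j.
- by rewrite last_cat dropE -[in RHS](cat_take_drop j q) last_cat dropE.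
- by move=> u; rewrite mem_cat => /orP[/mem_take | /mem_drop].
by rewrite size_cat size_takel // size_drop -[X in _ < X](subnKC (ltnW ltjq)) ltn_add2r.
Qed.

Hypotheses (e_sym : symmetric e) (e_irr : irreflexive e) (chordal_e : chordal e).

(* Otherwise a shortest path from [y] to [z] inside [W] closes up through [x] to
   a chordless cycle. *)
Lemma common_neighbors_adjacent (x y z : V) (W : pred V) :
    y != z -> e x y -> e x z -> ~~ W x ->
    (forall u, W u -> e x u -> (u == y) || (u == z)) ->
    (exists q, [/\ path e y q, last y q = z & all W (y :: q)]) ->
  e y z.
Proof.
move=> y'z exy exz W'x Wx [q0 [e_q0 last_q0 W_q0]].
pose P n := [exists q : n.-tuple V, [&& path e y q, last y q == z & all W (y :: q)]].
have exP : exists n, P n.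
  by exists (size q0); apply/existsP; exists (in_tuple q0); rewrite e_q0 last_q0 eqxx.
have [n /existsP[qn /and3P[e_qn /eqP last_qn W_qn]] min_n] := ex_minnP exP.
have min_q q : path e y q -> last y q = z -> all W (y :: q) -> n <= size q.
  move=> e_q last_q W_q; apply: min_n; apply/existsP; exists (in_tuple q).
  by rewrite e_q last_q eqxx.
have [q [e_q last_q W_q Uq] min_q'] : exists2 q,
    [/\ path e y q, last y q = z, all W (y :: q) & uniq (y :: q)] & size q <= n.
  case: (shortenP e_qn) last_qn => q e_q Uq sub_q last_q; exists q; last first.
    by rewrite -(size_tuple qn) uniq_leq_size //; case/andP: Uq.
  have [Wy Wqn] := andP W_qn.
  by split=> //=; rewrite Wy; apply/allP=> u /sub_q; apply: (allP Wqn).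
apply: contraT => not_eyz; pose c := x :: y :: q.
have zq : nth x (y :: q) (size q) = z by rewrite -last_q (last_nth x).
have q'x u : u \in y :: q -> (x == u) = false.
  by move=> q_u; apply: contraNF W'x => /eqP->; apply: (allP W_q).
have Uc : uniq c by rewrite /c cons_uniq Uq andbT; apply/negP=> /q'x; rewrite eqxx.
(* A shorter [q] would give [y = z] or [e y z]; hence the cycle [c] has at least four vertices. *)
have q_gt1 : 1 < size q.
  move: last_q e_q; case: (q) => [|a [|b q1]] //= eqz; first by rewrite eqz eqxx in y'z.
  by rewrite eqz (negPf not_eyz).
(* An edge from [x] into the path reaches only [y] or [z], its neighbors on the cycle; a chord of
   the path would shorten it. *)
have nchord i j : i < j -> j < size c -> e (nth x c i) (nth x c j) ->
    nth x c j == next c (nth x c i) \/ nth x c i == next c (nth x c j).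
  move=> ltij ltjc; rewrite !next_nth_uniq // ?(ltn_trans ltij) //.
  case: i j ltij ltjc => [|i] [|j] // ltij ltjc eij.
    have q_j : nth x (y :: q) j \in y :: q by rewrite mem_nth.
    have [jy | /eqP jz] := orP (Wx _ (allP W_q _ q_j) eij); first by left; rewrite /= jy.
    right; have -> : j = size q.
      by apply/eqP; rewrite -(nth_uniq x _ _ Uq) //= zq -jz.
    by rewrite (nth_default x (n := (size q).+1)).
  have [ji | ij] := eqVneq j i.+1; first by left; rewrite ji.
  have lt2 : i.+1 < j by rewrite ltn_neqAle eq_sym ij.
  have eij' : e (nth y (y :: q) i) (nth y (y :: q) j).
    by rewrite !(set_nth_default x y) //; apply: ltn_trans ltij ltjc.
  have [q' [e_q' last_q' sub_q' ltq']] := path_shortcut e_q lt2 ltjc eij'.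
  have W_q' : all W (y :: q').
    by have /andP[Wy Wq] := W_q; rewrite /= Wy; apply/allP=> u /sub_q'; apply: (allP Wq).
  have := leq_trans min_q' (min_q q' e_q' (etrans last_q' last_q) W_q').
  by rewrite leqNgt ltq'.
have /negP[] : ~~ chordless e c.
  apply: chordal_e => //; rewrite /ucycle Uc andbT /=.
  by rewrite exy rcons_path e_q last_q e_sym exz.
apply/forall_inP=> u /(nthP x)[i lti <-]; apply/forall_inP=> w /(nthP x)[j ltj <-].
apply/implyP=> eij; have [ltij | ltji | eq_ij] := ltngtP i j.
- by case: (nchord i j) => // ->; rewrite ?orbT.
- by case: (nchord j i) => //; rewrite 1?e_sym // => ->; rewrite ?orbT.
by rewrite eq_ij e_irr in eij.
Qed.

(* Let [C] be the component of [y] among the vertices other than [x] not adjacent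
   to [x], and [B] its boundary. [B] lies in the neighborhood of [x], so it is a
   clique; hence, by induction on C :|: B, some vertex of [C] is simplicial. *)
Lemma simplicial_avoiding (S : {set V}) x y : x \in S -> y \in S -> x != y -> ~~ e x y ->
  exists v, [/\ v \in S, v != x, ~~ e x v & simplicial e S v].
Proof.
have [n] := ubnP #|S|; elim: n => // n IHn in S x y *; rewrite ltnS => leSn Sx Sy x'y not_exy.
pose far u := [&& u \in S, u != x & ~~ e x u].
pose h : rel V := fun u w => [&& e u w, far u & far w].
have h_sym : connect_sym h.
  by apply: sym_connect_sym => u w; rewrite /h e_sym [far u && _]andbC.
pose C := [set u | connect h y u].
have far_y : far y by rewrite /far Sy eq_sym x'y.
have Cfar u : u \in C -> far u.
  rewrite inE => /connectP[p h_p ->].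
  by elim/last_ind: p h_p => // p w _; rewrite rcons_path last_rcons => /and4P[].
have Cstep u w : u \in C -> e u w -> far w -> w \in C.
  move=> Cu euw far_w; have far_u := Cfar u Cu.
  by move: Cu; rewrite !inE => /connect_trans; apply; rewrite connect1 // /h euw far_u.
pose B := [set w in S | e x w && [exists u in C, e u w]].
have CB u w : u \in C -> w \in S -> e u w -> w \in C :|: B.
  move=> Cu Sw euw; rewrite in_setU; have [// | C'w] := boolP (w \in C).
  have /and3P[_ u'x not_exu] := Cfar u Cu.
  have : ~~ far w by apply: contra C'w; apply: Cstep euw.
  rewrite inE Sw /far Sw /= negb_and !negbK => /orP[/eqP w_x | ->].
    by rewrite e_sym -w_x euw in not_exu.
  by apply/exists_inP; exists u.
have B_clique : {in B &, forall w w', w != w' -> e w w'}.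
  move=> w w'; rewrite !inE => /and3P[Sw exw /exists_inP[u Cu euw]].
  move=> /and3P[Sw' exw' /exists_inP[u' Cu' euw']] ww'.
  (* The path from [w] to [w'] runs through the component [C], which has no neighbor of [x]. *)
  apply: (@common_neighbors_adjacent x w w' [pred a | [|| a == w, a == w' | a \in C]]) => //=.
  - rewrite !negb_or; apply/and3P; split.
    + by apply: contraTneq exw => <-; rewrite e_irr.
    + by apply: contraTneq exw' => <-; rewrite e_irr.
    by apply/negP=> /Cfar/and3P[_ /eqP].
  - move=> a /or3P[-> // | -> | /Cfar/and3P[_ _ /negPf->]] //.
    by rewrite orbT.
  have /connectP[p h_p u'E] : connect h u u'.
    by move: Cu Cu'; rewrite !inE h_sym => /connect_trans; apply.
  exists (u :: rcons p w'); rewrite /= last_rcons rcons_path -u'E euw' all_rcons /=.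
  rewrite e_sym euw (sub_path _ h_p) => [|? ? /and3P[]//]; split=> //.
  rewrite eqxx Cu eqxx !orbT /=; apply/allP=> a p_a /=.
  suff -> : a \in C by rewrite !orbT.
  have /connect_trans : connect h y u by rewrite inE in Cu.
  rewrite inE; apply; apply: (path_connect h_p) => //; first by rewrite inE p_a orbT.
(* All neighbors in [S] of a vertex of [C] lie in [C :|: B]. *)
have lift v : v \in C -> simplicial e (C :|: B) v ->
    exists v, [/\ v \in S, v != x, ~~ e x v & simplicial e S v].
  move=> Cv simpl_v; have /and3P[Sv v'x not_exv] := Cfar v Cv.
  exists v; split=> // a b Sa Sb eva evb.
  by apply: simpl_v => //; apply: (CB v).
have ltS : #|C :|: B| < n.
  apply: leq_trans leSn; apply: proper_card; apply/properP; split.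
    by apply/subsetP=> a; rewrite in_setU => /orP[/Cfar/and3P[] | /setIdP[]].
  exists x; rewrite // in_setU negb_or; apply/andP; split.
    by apply/negP=> /Cfar/and3P[_ /eqP].
  by rewrite inE e_irr andbF.
have [/exists_inP[a ABa /exists_inP[b ABb /andP[a'b not_eab]]] | complete] :=
  boolP [exists a in C :|: B, exists b in C :|: B, (a != b) && ~~ e a b]; last first.
  have Cy : y \in C by rewrite inE connect0.
  apply: (lift y) => // a b ABa ABb _ _ a'b.
  apply: contraR complete => not_eab; apply/exists_inP; exists a => //.
  by apply/exists_inP; exists b; rewrite // a'b.
(* If [v] falls in [B], a second use of the induction hypothesis gives a simplicial [u] not adjacent
   to [v]; as [B] is a clique, [u] is in [C]. *)
have [v [ABv v'a not_eav simpl_v]] := IHn _ _ _ ltS ABa ABb a'b not_eab.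
have [/lift | C'v] := boolP (v \in C); first exact.
have Bv : v \in B by move: ABv; rewrite in_setU (negPf C'v).
have not_eva : ~~ e v a by rewrite e_sym.
have [u [ABu u'v not_evu simpl_u]] := IHn _ _ _ ltS ABv ABa v'a not_eva.
apply: (lift u) => //; move: ABu; rewrite in_setU => /orP[// | Bu].
by rewrite B_clique // eq_sym in not_evu.
Qed.

(** Dirac's theorem, for the subgraph induced on [S]; in a complete one every vertex is
    simplicial. *)
Lemma chordal_simplicial (S : {set V}) : S != set0 ->
  exists2 v, v \in S & simplicial e S v.
Proof.
have [/exists_inP[x Sx /exists_inP[y Sy /andP[x'y not_exy]]] _ | complete /set0Pn[v Sv]] :=
  boolP [exists x in S, exists y in S, (x != y) && ~~ e x y].
  by have [v [Sv _ _]] := simplicial_avoiding Sx Sy x'y not_exy; exists v.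
exists v => // x y Sx Sy _ _ x'y.
apply: contraR complete => not_exy; apply/exists_inP; exists x => //.
by apply/exists_inP; exists y; rewrite // x'y.
Qed.

End Chordal.

(** * Dicuts as ideals, and packings from colorings of copies *)

Section Woodall.

Variables (D : digraph) (w : arcs D -> nat).

Lemma underlying_sym : symmetric (@underlying D).
Proof.
move=> x y; rewrite /underlying eq_sym; congr andb.
by apply: eq_existsb => a; rewrite orbC.
Qed.

Lemma underlying_irr : irreflexive (@underlying D).
Proof. by move=> x; rewrite /underlying eqxx. Qed.

Definition arc_rel : rel (vertices D) := fun x y =>
  [exists a : arcs D, (src a == x) && (tgt a == y)].

Lemma dicutP C :
  reflect (exists2 U, ideal setT arc_rel U & C = delta_out U) (dicut C).
Proof.
apply: (iffP existsP) => [[U /and4P[U0 UT inU /eqP->]] | [U idU ->]]; exists U => //.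
  apply/idealP; split; rewrite ?subsetT -?properT //.
  move=> x y _ _ /existsP[a /andP[/eqP<- /eqP<-]] Uta.
  by apply: contraTT inU => U'sa; apply/set0Pn; exists a; rewrite inE U'sa.
have /idealP[_ U0 UT cl] := idU; rewrite U0 properT UT eqxx andbT /=.
apply/set0Pn=> -[a]; rewrite inE => /andP[/negP U'sa Uta]; apply: U'sa.
apply: cl Uta; rewrite ?in_setT //.
by apply/existsP; exists a; rewrite !eqxx.
Qed.

Lemma dijoin_hits (J C : {set arcs D}) : dijoin J -> dicut C -> 0 < #|J :&: C|.
Proof. by move/forallP/(_ C)/implyP=> hit /hit; rewrite card_gt0. Qed.

(** Double counting of the pairs of a dijoin in the list and an arc of [C] in it. *)
Lemma packing_size_le Js C : packing w Js -> dicut C -> size Js <= weight w C.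
Proof.
case=> /allP dijJs le_w dC; apply: leq_trans (_ : \sum_(J <- Js) #|J :&: C| <= _).
  rewrite -sum1_size big_seq [X in _ <= X]big_seq; apply: leq_sum => J /dijJs dJ.
  exact: dijoin_hits.
apply: leq_trans (_ : \sum_(a in C) count (fun J : {set arcs D} => a \in J) Js <= _); last first.
  by apply: leq_sum => a _; apply: le_w.
rewrite (eq_bigr (fun a => \sum_(J <- Js | a \in J) 1)) => [|a _]; last by rewrite sum1_count.
rewrite (exchange_big_dep predT) //=.
apply: leq_sum => J _; rewrite -sum1_card eq_leq //.
by apply: eq_bigl => a; rewrite inE andbC.
Qed.

Let copies : finType := {a : arcs D & 'I_(w a)}.

Lemma card_copies (C : {set arcs D}) :
  #|[set u : copies | tag u \in C]| = weight w C.
Proof.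
rewrite /weight -sum1_card (eq_bigr (fun a => \sum_(i < w a) 1)); last first.
  by move=> a _; rewrite sum1_card card_ord.
rewrite sig_big_dep /=; apply: eq_bigl => u; by rewrite !inE andbT.
Qed.

Lemma exists_packing k : chordal (@underlying D) ->
    (forall C, dicut C -> k <= weight w C) ->
  exists2 Js, packing w Js & size Js = k.
Proof.
move=> chordalD le_k.
have or_r : orients (@underlying D) setT arc_rel.
  move=> x y _ _ x'y; rewrite /underlying x'y /=; apply/existsP/orP.
    by case=> a /orP[]; [left | right]; apply/existsP; exists a.
  by case=> /existsP[a a_xy]; exists a; rewrite a_xy ?orbT.
pose s (u : copies) := src (tag u); pose t (u : copies) := tgt (tag u).
have crossE U : crossing s t U = [set u : copies | tag u \in delta_out U].
  by apply/setP=> u; rewrite !inE.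
have wp : well_placed setT arc_rel s t.
  by move=> u _; split=> //; apply/existsP; exists (tag u); rewrite !eqxx.
have [|c cP] := dijoin_coloring_chordal
    (chordal_simplicial underlying_sym underlying_irr chordalD) or_r wp (k := k).
  by move=> U idU; rewrite crossE card_copies le_k //; apply/dicutP; exists U.
pose J i := [set a | [exists i' : 'I_(w a), c (Tagged (fun a => 'I_(w a)) i') == i]].
exists [seq J i | i <- iota 0 k]; last by rewrite size_map size_iota.
split.
  apply/allP=> _ /mapP[i + ->]; rewrite mem_iota => /andP[_ ltik].
  apply/forallP=> C; apply/implyP=> /dicutP[U idU ->].
  have [u] := cP U i idU ltik; rewrite crossE inE => cross_u cu.
  apply/set0Pn; exists (tag u); rewrite inE cross_u andbT inE.
  by apply/existsP; exists (tagged u); rewrite -cu; case: (u).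
move=> a; rewrite count_map -size_filter.
(* The colors whose dijoin contains [a] are colors of its [w a] copies. *)
pose cs := [seq c (Tagged (fun a => 'I_(w a)) i) | i <- enum 'I_(w a)].
have <- : size cs = w a by rewrite size_map size_enum_ord.
apply: uniq_leq_size; first by rewrite filter_uniq ?iota_uniq.
move=> i; rewrite mem_filter /= inE => /andP[/existsP[j /eqP <-] _].
by apply: map_f; rewrite mem_enum.
Qed.

End Woodall.

Theorem theorem1 (D : digraph) (w : arcs D -> nat)
    (chordalD : chordal (@underlying D)) :
  exists m : option nat, is_min_dicut_weight w m /\ is_max_packing_size w m.
Proof.
have [/existsP[C0 dC0] | /existsPn no_dicut] := boolP [exists C : {set arcs D}, dicut C].
  have [C dC min_C] := @arg_minnP _ C0 (@dicut D) (weight w) dC0.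
  exists (Some (weight w C)); split; split=> //; first by exists C.
    exact: exists_packing.
  by move=> Js packJs; apply: packing_size_le.
exists None; split=> // n; exists (nseq n set0); last by rewrite size_nseq.
split=> [|a]; last by rewrite count_nseq inE.
rewrite all_nseq; apply/orP; right; apply/forallP=> C.
by rewrite (negPf (no_dicut C)).
Qed.
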